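(* For integers $m\ge n$ put $\mathcal{R}(m,n)=\min\left\{n,\left\lfloor\frac{m+n}{3}\right\rfloor+1\right\}$. (1) Let $G=(X,Y;E)$ be a finite simple bipartite graph with $|X|=m\ge n=|Y|$. If $k(G)\ge\mathcal{R}(m,n)$ or $k'(G)\ge\mathcal{R}(m,n)$, where $k(G)$ is the (vertex) connectivity and $k'(G)$ the edge-connectivity of $G$, then $\kappa_{\mathrm{LLY}}(x,y)>0$ for every edge $xy$ of $G$. (2) The threshold is sharp: for all integers $m\ge n\ge 2$ there exists a bipartite graph $G_0=(X,Y;E)$ with $|X|=m$, $|Y|=n$ and $k(G_0)=k'(G_0)=\mathcal{R}(m,n)-1$ that contains an edge $xy$ with $\kappa_{\mathrm{LLY}}(x,y)\le 0$.
   Context: All graphs are finite and simple. The connectivity $k(G)$ of a non-complete graph is the minimum number of vertices whose removal disconnects the graph; $k(K_n)=n-1$. The edge-connectivity $k'(G)$ of a graph with at least two vertices is the minimum number of edges whose removal disconnects it; it is $0$ for a single vertex. Let $\rho$ denote graph distance and $d_x$ the degree of a vertex $x$. For probability measures $\mu_1,\mu_2$ on $V(G)$, the $L^1$-Wasserstein distance is $W(\mu_1,\mu_2)=\inf_\pi\sum_{u,v\in V}\rho(u,v)\pi(u,v)$, the infimum over $\pi:V\times V\to[0,1]$ with $\sum_v\pi(u,v)=\mu_1(u)$ for all $u$ and $\sum_u\pi(u,v)=\mu_2(v)$ for all $v$. For $\alpha\in[0,1]$ and a vertex $x$, $\mu_x^\alpha$ is the measure with $\mu_x^\alpha(x)=\alpha$,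 $\mu_x^\alpha(z)=\frac{1-\alpha}{d_x}$ if $z$ is adjacent to $x$, and $0$ otherwise. For an edge $xy$ (so $\rho(x,y)=1$), $\kappa_\alpha(x,y)=1-W(\mu_x^\alpha,\mu_y^\alpha)$ and the Lin--Lu--Yau curvature is $\kappa_{\mathrm{LLY}}(x,y)=\lim_{\alpha\to1^-}\frac{\kappa_\alpha(x,y)}{1-\alpha}$. (For edges, all the measures involved are supported in one connected component.) *)

(* Defs.v *)
From HB Require Import structures.
From mathcomp Require Import all_boot all_order all_algebra.
From mathcomp Require Import all_classical all_reals all_analysis.

Set Implicit Arguments.
Unset Strict Implicit.
Unset Printing Implicit Defensive.

Import Order.TTheory GRing.Theory Num.Theory.
Import numFieldNormedType.Exports.

Section Graph.
Variable T : finType.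
Implicit Types (e : rel T) (S X Y : {set T}) (F : {set {set T}}).

Definition simple_graph e : Prop := symmetric e /\ irreflexive e.

Definition bipartition e X Y : Prop :=
  [/\ [disjoint X & Y], (X :|: Y)%SET = [set: T]%SET :> {set T} &
      forall x y, e x y ->
        (x \in X) && (y \in Y) || (x \in Y) && (y \in X)].

Definition complete_graph e : bool :=
  [forall x, forall y, (x != y) ==> e x y].

Definition del_vertices e S : rel T :=
  [rel x y | [&& x \notin S, y \notin S & e x y]].

Definition vertex_cut e S : bool :=
  [exists x in (~: S)%SET, exists y in (~: S)%SET,
    ~~ connect (del_vertices e S) x y].

(* A non-complete graph has a vertex cut, of size at most #|T|, so the default
   value of the minimum plays no role. *)
Definition connectivity e : nat :=
  if complete_graph e then #|T|.-1
  else \big[minn/#|T|]_(S : {set T} | vertex_cut e S) #|S|.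

Definition edges e : {set {set T}} :=
  [set f : {set T} | [exists x, exists y, e x y && (f == [set x; y]%SET)]]%SET.

Definition del_edges e F : rel T :=
  [rel x y | e x y && ([set x; y]%SET \notin F)].

Definition edge_cut e F : bool :=
  (F \subset edges e) && [exists x, exists y, ~~ connect (del_edges e F) x y].

(* With at least two vertices, edges e itself is an edge cut, so the default
   value of the minimum plays no role. *)
Definition edge_connectivity e : nat :=
  if (#|T| <= 1)%N then 0%N
  else \big[minn/#|edges e|]_(F : {set {set T}} | edge_cut e F) #|F|.

Definition has_walk e (x y : T) (k : nat) : bool :=
  [exists p : k.-tuple T, path e x p && (last x p == y)].

(* Vertices in different components get the junk value #|T|. This never
   matters below: the marginals of a coupling of mu_x and mu_y, for an edge
   xy, are supported in the component of x and y, so the coupling vanishes on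
   pairs of vertices in different components. *)
Definition dist e (x y : T) : nat :=
  \big[minn/#|T|]_(k < #|T| | has_walk e x y k) k.

Definition degree e (x : T) : nat := #|[set z | e x z]%SET|.

End Graph.

Section Curvature.
Local Open Scope classical_set_scope.
Local Open Scope ring_scope.
Variables (R : realType) (T : finType) (e : rel T).

Definition coupling (mu1 mu2 : T -> R) (p : T -> T -> R) : Prop :=
  [/\ forall u v, 0 <= p u v <= 1,
      forall u, \sum_v p u v = mu1 u &
      forall v, \sum_u p u v = mu2 v].

Definition transport_cost (p : T -> T -> R) : R :=
  \sum_u \sum_v (dist e u v)%:R * p u v.

Definition wasserstein (mu1 mu2 : T -> R) : R :=
  inf [set transport_cost p | p in coupling mu1 mu2].

Definition lazy_measure (alpha : R) (x z : T) : R :=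
  if z == x then alpha
  else if e x z then (1 - alpha) / (degree e x)%:R
  else 0.

Definition kappa (alpha : R) (x y : T) : R :=
  1 - wasserstein (lazy_measure alpha x) (lazy_measure alpha y).

Definition kappa_LLY (x y : T) : R :=
  lim (kappa alpha x y / (1 - alpha) @[alpha --> (1 : R)^'-]).

End Curvature.

Definition Rthreshold (m n : nat) : nat := minn n ((m + n) %/ 3).+1.

(* Main.v *)
Require Import Defs.
From HB Require Import structures.
From mathcomp Require Import all_boot.
From mathcomp Require Import zify.

Set Implicit Arguments.
Unset Strict Implicit.
Unset Printing Implicit Defensive.

(* Positivity. Both connectivities are at most the minimum degree. Transporting
   the atom of mu_x to y and the rest of mu_x to N(y) along edges costs exactly
   1, and by Hall's theorem this can be done so that part of the mass at y goes
   to x as soon as d_y |S| < d_x |N(S) /\ N(y)| for all nonempty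
   S <= N(x) \ {y}. Such mass can be left in place, together with an equal part
   of the atom, so the curvature is positive. If S violates the inequality,
   summing the degrees of a vertex of S and of a vertex of N(y) without
   neighbours in S shows that three times the minimum degree is at most m + n.
   When R(m,n) = n the graph is complete bipartite and there is no such S.

   Sharpness. With r = R(m,n) - 1 and s = n - r, the graph K_{m,n} minus three
   complete bipartite graphs contains an edge xy with d_x = d_y, s neighbours of
   x other than y, and s neighbours of y including x, such that the former are
   joined to no other neighbour of y. A 1-Lipschitz function with values in
   {-1, 0, 1, 2} witnesses that the Wasserstein distances are at least 1. *)

(** * Hall's theorem *)

(** Induction on the size of [D] by the Halmos-Vaughan dichotomy: either some nonempty proper subset
    is tight, with exactly as many neighbours as elements, or every such subset has a neighbour to
    spare. *)
Lemma hall_marriage (A B : finType) (b0 : B) (r : A -> B -> bool) (D : {set A}) :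
  (forall S : {set A}, S \subset D ->
     #|S| <= #|[set b | [exists a in S, r a b]]|) ->
  exists f : A -> B, {in D &, injective f} /\ {in D, forall a, r a (f a)}.
Proof.
have [k] := ubnP #|D|; elim: k D r => // k IH D r; rewrite ltnS => leDk hall.
have [->|/set0Pn[a aD]] := eqVneq D set0.
  by exists (fun=> b0); split=> ? ; rewrite inE.
have [/existsP[S /and3P[SD Sn0 /eqP cS]]|noS] := boolP [exists S : {set A},
    [&& S \proper D, S != set0 &
        #|S| == #|[set b | [exists a in S, r a b]]|]].
- set NS := [set b | [exists a in S, r a b]] in cS.
  have leS : (#|S| < #|D|) by exact: proper_card.
  have [||f1 [f1I f1r]] := IH S r; first exact: leq_trans leDk.
    by move=> S' S'S; apply: hall; apply: subset_trans S'S (proper_sub SD).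
  have cD : (#|D :\: S| < k).
    apply: leq_trans leDk; rewrite cardsD (setIidPr (proper_sub SD)).
    by move: Sn0; rewrite -card_gt0; lia.
  (* Outside a tight [S] only targets outside [NS] are allowed. Hall's condition for [S'] is then
     the one for [S' :|: S] with the equal sizes of [S] and [NS] cancelled. *)
  have [|f2 [f2I f2r]] := IH (D :\: S) (fun a b => r a b && (b \notin NS)) cD.
    move=> S' S'D.
    have S'S : [disjoint S' & S].
      by rewrite disjoints_subset; apply: subset_trans S'D _; rewrite setDE subsetIr.
    have := hall (S' :|: S); rewrite subUset (proper_sub SD) andbT.
    rewrite (subset_trans S'D (subsetDl _ _)) => /(_ isT).
    have -> : #|(S' :|: S)| = (#|S'| + #|S|) by apply/eqP; rewrite (leq_card_setU S' S).
    set N1 := finset _; set N2 := finset _ => h.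
    have : N1 \subset N2 :|: NS.
      apply/subsetP => b; rewrite !inE => /exists_inP[c + rcb].
      rewrite !inE => /orP[cS'|cS0]; last by apply/orP; right; apply/exists_inP; exists c.
      have [bN|bN] := boolP (b \in NS); first by move: bN; rewrite inE => ->; rewrite orbT.
      by move: bN; rewrite inE => bN; apply/orP; left; apply/exists_inP; exists c;
        rewrite ?rcb.
    move/subset_leq_card; have := (leq_card_setU N2 NS).1.
    lia.
  exists (fun a => if a \in S then f1 a else f2 a).
  have f2N x : x \in D -> x \notin S -> f2 x \notin NS.
    by move=> xD xS; have /f2r/andP[] : x \in D :\: S by rewrite inE xS.
  have f1N x : x \in S -> f1 x \in NS.
    by move=> xS; rewrite inE; apply/exists_inP; exists x => //; apply: f1r.
  split.
    move=> x y xD yD; case: ifPn => xS; case: ifPn => yS.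
    - exact: f1I.
    - by move=> E; have := f2N _ yD yS; rewrite -E f1N.
    - by move=> E; have := f2N _ xD xS; rewrite E f1N.
    - by apply: f2I; rewrite inE ?xS ?yS.
  move=> x xD /=; case: ifPn => xS; first exact: f1r.
  by have /f2r/andP[] : x \in D :\: S by rewrite inE xS.
have := hall [set a]; rewrite sub1set => /(_ aD); rewrite cards1 card_gt0.
case/set0Pn => b; rewrite inE => /exists_inP[c]; rewrite inE => /eqP-> rab.
have cD : (#|D :\ a| < k) by apply: leq_trans leDk; rewrite [leqRHS](cardsD1 a) aD.
(* Without tight subsets, discarding [b] costs each set at most its spare neighbour. *)
have [|f [fI fr]] := IH (D :\ a) (fun a b' => r a b' && (b' != b)) cD.
  move=> S SD; have [->|Sn0] := eqVneq S set0; first by rewrite cards0.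
  have SpD : S \proper D.
    by apply: sub_proper_trans SD _; apply: properD1.
  have := hall _ (proper_sub SpD); rewrite leq_eqVlt => /orP[E|].
    by move/existsPn: noS => /(_ S); rewrite SpD Sn0 E.
  set N1 := finset _; set N2 := finset _ => h.
  have : N1 \subset b |: N2.
    apply/subsetP => b'; rewrite !inE => /exists_inP[c' cS' rcb].
    have [//|bN] := eqVneq b' b.
    by apply/exists_inP; exists c' => //; rewrite rcb.
  move/subset_leq_card; rewrite cardsU1 => h'; have := leq_trans h h'.
  by case: (b \notin N2) => //=; lia.
exists (fun x => if x == a then b else f x).
have fD x : x \in D -> x != a -> r x (f x) && (f x != b).
  by move=> xD xa; apply: fr; rewrite !inE xa.
split.
  move=> x y xD yD; case: eqVneq => [->|xa]; case: eqVneq => [->|ya] //.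
  - by move=> E; have /andP[_] := fD _ yD ya; rewrite -E eqxx.
  - by move=> E; have /andP[_] := fD _ xD xa; rewrite E eqxx.
  - by apply: fI; rewrite !inE ?xa ?ya.
by move=> x xD /=; case: eqVneq => [->|xa] //; case/andP: (fD _ xD xa).
Qed.

(** * Connectivity, edge-connectivity and degrees *)

Lemma bigminn_le (I : finType) (d : nat) (P : pred I) (F : I -> nat) (j : I) :
  P j -> \big[minn/d]_(i | P i) F i <= F j.
Proof.
move=> Pj; have := mem_index_enum j; elim: (index_enum I) => // i s IH.
rewrite inE big_cons => /predU1P[<-|/IH h]; first by rewrite Pj geq_minl.
by case: ifP => _ //; rewrite geq_min h orbT.
Qed.

Lemma leq_bigminn (I : finType) (d : nat) (P : pred I) (F : I -> nat) (k : nat) :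
  k <= d -> (forall i, P i -> k <= F i) -> k <= \big[minn/d]_(i | P i) F i.
Proof.
by move=> kd kF; elim/big_ind: _ => // a b ka kb; rewrite leq_min ka kb.
Qed.

Lemma mem_connect_closed (T : finType) (e : rel T) (P : {set T}) (x y : T) :
  (forall u v, u \in P -> e u v -> v \in P) -> x \in P -> connect e x y -> y \in P.
Proof.
move=> eP xP /connectP[p + ->]; elim: p x xP => //= v p IH x xP /andP[xv].
by apply: IH; apply: eP xv.
Qed.

Lemma complete_graph_degree (T : finType) (e : rel T) (v : T) :
  irreflexive e -> complete_graph e -> degree e v = #|T|.-1.
Proof.
move=> ei /forallP ce; rewrite /degree; have -> : [set z | e v z] = ~: [set v].
  apply/setP => z; rewrite !inE; have [->|zv] := eqVneq z v; first by rewrite ei.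
  by have /forallP/(_ z)/implyP := ce v; rewrite eq_sym zv => ->.
by rewrite cardsC1.
Qed.

Lemma degree_lt (T : finType) (e : rel T) (v : T) :
  irreflexive e -> degree e v < #|T|.
Proof.
move=> ei; rewrite -cardsT; apply: proper_card; apply/properP; split=> //.
by exists v; rewrite ?inE ?ei.
Qed.

Lemma connectivity_le_cut (T : finType) (e : rel T) (S : {set T}) :
  ~~ complete_graph e -> vertex_cut e S -> connectivity e <= #|S|.
Proof. by rewrite /connectivity => /negPf-> cS; apply: bigminn_le. Qed.

Lemma vertex_cutI (T : finType) (e : rel T) (S P : {set T}) (u v : T) :
  u \notin S -> v \notin S -> u \in P -> v \notin P ->
  (forall a b, a \in P -> a \notin S -> b \notin S -> e a b -> b \in P) ->
  vertex_cut e S.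
Proof.
move=> uS vS uP vP clP; apply/exists_inP; exists u; rewrite ?inE //.
apply/exists_inP; exists v; rewrite ?inE //; apply: contra vP.
apply: mem_connect_closed uP => a b aP /and3P[aS bS ab]; exact: clP ab.
Qed.

(** The neighbours of [v] separate it from any non-neighbour. If [v] is adjacent to all other
    vertices of a non-complete graph, the complement of a nonadjacent pair is a cut with fewer than
    [degree e v] vertices. *)
Lemma connectivity_le_degree (T : finType) (e : rel T) (v : T) :
  simple_graph e -> connectivity e <= degree e v.
Proof.
move=> [es ei]; have [ce|ce] := boolP (complete_graph e).
  by rewrite /connectivity ce (complete_graph_degree v ei ce).
have [/forall_inP vT|] := boolP [forall z in ~: [set v], e v z].
  have -> : degree e v = #|T|.-1.
    rewrite /degree; have -> : [set z | e v z] = ~: [set v]; last by rewrite cardsC1.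
    apply/setP => z; rewrite !inE; have [->|zv] := eqVneq z v; first by rewrite ei.
    by rewrite vT // !inE.
  have := ce; rewrite negb_forall => /existsP[a]; rewrite negb_forall => /existsP[b].
  rewrite negb_imply => /andP[ab nab].
  apply: leq_trans (connectivity_le_cut ce (S := ~: [set a; b]) _) _.
    apply: (@vertex_cutI _ e _ [set a] a b); rewrite ?inE ?negbK ?eqxx ?orbT //.
      by rewrite eq_sym.
    move=> c d; rewrite !inE !negbK => /eqP-> _ /pred2P[->|->] //.
    by rewrite (negPf nab).
  by rewrite cardsCs setCK cards2 ab; lia.
rewrite negb_forall => /existsP[z]; rewrite negb_imply !inE => /andP[zv nvz].
apply: connectivity_le_cut => //.
apply: (@vertex_cutI _ e _ [set v] v z); rewrite ?inE ?ei //.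
by move=> a b; rewrite !inE => /eqP-> _ /negPf->.
Qed.

Lemma edges2 (T : finType) (e : rel T) (x y : T) : e x y -> [set x; y] \in edges e.
Proof.
by move=> exy; rewrite inE; apply/existsP; exists x; apply/existsP; exists y; rewrite exy eqxx.
Qed.

Lemma set2_inj (T : finType) (x y z : T) : [set x; y] = [set x; z] -> y = z.
Proof.
move=> E; have : y \in [set x; z] by rewrite -E !inE eqxx orbT.
have : z \in [set x; y] by rewrite E !inE eqxx orbT.
by rewrite !inE => /pred2P[->|->] // /pred2P[].
Qed.

Lemma edge_connectivity_le_degree (T : finType) (e : rel T) (v : T) :
  simple_graph e -> edge_connectivity e <= degree e v.
Proof.
move=> [es ei]; rewrite /edge_connectivity; case: (leqP #|T| 1) => // T1.
have [a [b [_ _ ab]]] := card_gt1P T1.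
have [z zv] : exists z, z != v.
  have [E|] := eqVneq a v; last by exists a.
  by exists b; rewrite -E eq_sym.
pose F := [set [set v; u] | u in [set u | e v u]].
have FE : edge_cut e F.
  apply/andP; split.
    by apply/subsetP => f /imsetP[u]; rewrite inE => vu ->; apply: edges2.
  apply/existsP; exists v; apply/existsP; exists z; apply/negP => vz.
  have : z \in [set v].
    apply: mem_connect_closed vz; last by rewrite inE.
    move=> c d; rewrite !inE => /eqP-> /andP[vd] /imsetP[].
    by exists d; rewrite ?inE.
  by rewrite inE (negPf zv).
apply: leq_trans (bigminn_le _ (fun F : {set {set T}} => #|F|) FE) _.
exact: leq_imset_card.
Qed.

(* Whitney: fix [u] on its side [P] of an edge cut, and delete its neighbours
   across the cut together with the other vertices of [P] having a neighbour
   across. Each deleted vertex owns a cut edge, and [u] gets separated from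
   whatever remains on the other side. *)
Lemma connectivity_le_edge_connectivity (T : finType) (e : rel T) :
  simple_graph e -> 1 < #|T| -> connectivity e <= edge_connectivity e.
Proof.
move=> se T1; have [es ei] := se; rewrite /edge_connectivity (leqNgt #|T| 1) T1 /=.
have /card_gt0P[t _] : 0 < #|T| by lia.
have cut_bound F : edge_cut e F -> connectivity e <= #|F|.
  move=> /andP[FE /existsP[x0 /existsP[y0 nc]]].
  pose P := [set z | connect (del_edges e F) x0 z].
  have x0P : x0 \in P by rewrite inE.
  have y0P : y0 \notin P by rewrite inE.
  have PF p q : p \in P -> q \notin P -> e p q -> [set p; q] \in F.
    rewrite !inE => pP qP pq; apply: contraR qP => pqF.
    apply: connect_trans pP _; by apply: connect1; apply/andP; split.
  pose D u := [set d | if d \in P then (d != u) && [exists q, (q \notin P) && e d q]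
                       else e u d].
  have DF u : u \in P -> #|D u| <= #|F|.
    move=> uP.
    (* [g] chooses the cut edge owned by a deleted vertex; on [D u] the [pick] always succeeds. *)
    pose g d := if d \in P then
        [set d; if [pick q | (q \notin P) && e d q] is Some q then q else d]
      else [set u; d].
    have gP d : d \in D u -> d \in P ->
        exists2 q, (q \notin P) && e d q & g d = [set d; q].
      rewrite inE /g => + dP; rewrite dP => /andP[du /existsP[q0 q0P]].
      by case: pickP => [q qP|/(_ q0)]; [exists q | rewrite q0P].
    have gI : {in D u &, injective g}.
      (* The edges owned by vertices outside [P] contain [u]; those owned by vertices of [P] do
         not. *)
      have mixed c d : c \in D u -> c \in P -> d \notin P -> g c <> g d.
        move=> cD cP dP; have [q /andP[qP cq] ->] := gP c cD cP.
        rewrite /g (negPf dP) => E.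
        have : u \in [set c; q] by rewrite E !inE eqxx.
        rewrite !inE => /pred2P[uc|uq]; last by rewrite -uq uP in qP.
        by move: cD; rewrite inE cP uc eqxx.
      move=> c d cD dD; have [cP|cP] := boolP (c \in P); have [dP|dP] := boolP (d \in P).
      - have [q /andP[qP _] ->] := gP c cD cP; have [q' /andP[qP' _] ->] := gP d dD dP.
        move=> E; have : c \in [set d; q'] by rewrite -E !inE eqxx.
        by rewrite !inE => /pred2P[//|E']; rewrite -E' cP in qP'.
      - by move/(mixed c d cD cP dP).
      - by move/esym/(mixed d c dD dP cP).
      - by rewrite /g (negPf cP) (negPf dP) => /set2_inj.
    rewrite -(card_in_imset gI); apply: subset_leq_card.
    apply/subsetP => _ /imsetP[d dD ->]; have [dP|dP] := boolP (d \in P).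
      by have [q /andP[qP dq] ->] := gP d dD dP; apply: PF.
    by rewrite /g (negPf dP); apply: PF => //; move: dD; rewrite inE (negPf dP).
  (* Either some [u] in [P] has a non-neighbour [v] across, and [D u] separates the two, or both
     sides are completely joined and [D x0] is everything but [x0]. *)
  have [|cPQ] := boolP [exists u in P, exists v in ~: P, ~~ e u v].
    case/exists_inP => u uP /exists_inP[v]; rewrite inE => vP nuv.
    apply: leq_trans (DF u uP); apply: connectivity_le_cut.
      rewrite /complete_graph negb_forall; apply/existsP; exists u.
      rewrite negb_forall; apply/existsP; exists v.
      by rewrite negb_imply nuv andbT; apply: contraNneq vP => <-.
    apply: (@vertex_cutI _ e _ P u v) => //.
    - by rewrite [u \in D u]inE uP eqxx.
    - by rewrite [v \in D u]inE (negPf vP).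
    move=> a b aP; rewrite [a \in D u]inE aP => aD bD ab; apply: contraR bD => bP.
    rewrite [b \in D u]inE (negPf bP).
    have [<-//|au] := eqVneq a u; move: aD; rewrite au /= => /existsPn/(_ b).
    by rewrite bP ab.
  apply: leq_trans (DF x0 x0P); apply: leq_trans (connectivity_le_degree x0 se) _.
  have := degree_lt x0 ei; suff: #|T|.-1 <= #|D x0| by lia.
  rewrite -(cardsC1 x0); apply: subset_leq_card; apply/subsetP => z.
  move: cPQ; rewrite negb_exists_in => /forall_inP cPQ.
  have {}cPQ p q : p \in P -> q \notin P -> e p q.
    move=> pP qP; have := cPQ p pP; rewrite negb_exists_in => /forall_inP/(_ q).
    by rewrite inE negbK; apply.
  rewrite 2!inE => zx; rewrite inE; case: ifPn => zP; last exact: cPQ.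
  by rewrite zx; apply/existsP; exists y0; rewrite y0P cPQ.
(* The default value of the minimum is the size of the cut consisting of all edges, so it obeys the
   same bound. *)
apply: leq_bigminn => //.
apply: cut_bound; rewrite /edge_cut subxx /=.
have [a [b [_ _ ab]]] := card_gt1P T1.
apply/existsP; exists a; apply/existsP; exists b; apply/negP => h.
have : b \in [set a].
  apply: mem_connect_closed h; last by rewrite inE.
  by move=> c d; rewrite !inE => _ /andP[cd]; rewrite edges2.
by rewrite inE eq_sym (negPf ab).
Qed.

(** * The extremal graph *)

(** Turns the degree and cut counts in the extremal graph into linear arithmetic. A single interval
    is obtained by leaving the second one empty. *)
Lemma card_ord_intervals (m k a b a' b' : nat) (A : {set 'I_m}) :
  a <= b -> b <= a' -> a' <= b' -> b' <= m -> k <= (b - a) + (b' - a') ->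
  (forall i : 'I_m, a <= i < b \/ a' <= i < b' -> i \in A) -> k <= #|A|.
Proof.
move=> ab ba' ab' bm kab pA.
pose p i := (a <= i < b) || (a' <= i < b').
have pAs : [set i : 'I_m | p i] \subset A.
  by apply/subsetP => i; rewrite inE => /orP; apply: pA.
apply: leq_trans kab (leq_trans _ (subset_leq_card pAs)).
have -> : #|[set i : 'I_m | p i]| = count p (iota 0 m).
  by rewrite cardsE cardE size_filter -val_enum_ord count_map enumT; apply: eq_count.
have full k1 l : (forall i, k1 <= i < k1 + l -> p i) -> count p (iota k1 l) = l.
  move=> pk; rewrite -[RHS](size_iota k1); apply/eqP; rewrite -all_count.
  by apply/allP => i; rewrite mem_iota; apply: pk.
have -> : m = a + ((b - a) + ((a' - b) + ((b' - a') + (m - b')))) by lia.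
rewrite !iotaD !count_cat (full _ (b - a)) ?(full _ (b' - a')); first lia.
  by move=> i ?; rewrite /p; lia.
by move=> i ?; rewrite /p; lia.
Qed.

Lemma card_sum_set (A B : finType) (D : {set A + B}) :
  #|D| = #|[set a | inl a \in D]| + #|[set b | inr b \in D]|.
Proof. by rewrite -!sum1_card big_sumType; congr (_ + _); apply: eq_bigl => ?; rewrite inE. Qed.

(** A matrix of ones with three zero blocks. The first two trim row 0 and column [s] to [c] ones
    each; the third prevents cheap transport between the neighbourhoods of the two ends. *)
Definition tight_adj (c s i j : nat) : bool :=
  ~~ [|| (i == 0) && (c <= j), (j == s) && (c <= i) | [&& s <= i, i < c & j < s]].

(* [inl 0 -- inr s] is the nonpositively curved edge: both ends have degree
   [c], and no edge joins the [s] neighbours [inr j] ([j < s]) of [inl 0] to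
   the [c - s] neighbours [inl i] ([s <= i < c]) of [inr s]. *)
Definition tight_graph (m n c s : nat) : rel ('I_m + 'I_n) :=
  fun u v => match u, v with
    | inl i, inr j | inr j, inl i => tight_adj c s i j
    | _, _ => false
    end.

Lemma tight_graph_simple (m n c s : nat) : simple_graph (@tight_graph m n c s).
Proof. by split=> [[i|j] [i'|j']|[i|j]]. Qed.

Lemma tight_graph_bipartition (m n c s : nat) :
  bipartition (@tight_graph m n c s) [set inl i | i : 'I_m] [set inr j | j : 'I_n].
Proof.
have inlE (z : 'I_m + 'I_n) : (z \in [set inl i | i : 'I_m]) = if z is inl _ then true else false.
  by case: z => z; [apply: imset_f | apply/imsetP => -[]].
have inrE (z : 'I_m + 'I_n) : (z \in [set inr i | i : 'I_n]) = if z is inr _ then true else false.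
  by case: z => z; [apply/imsetP => -[] | apply: imset_f].
split.
- by rewrite -setI_eq0; apply/eqP/setP => z; rewrite !inE inlE inrE; case: z.
- by apply/setP => z; rewrite !inE inlE inrE; case: z.
- by case=> [i|j] [i'|j']; rewrite ?inlE ?inrE.
Qed.

(** Rows from 1 to [c - 1] keep the [n - s = r] columns from [s] on. Columns below [s] lose only
    [c - s] rows, which [c + r <= m + s] allows. Every other row or column has at least [c] ones or
    misses only one entry. *)
Lemma tight_graph_degree_ge (m n r c s : nat) (v : 'I_m + 'I_n) :
  r <= c -> s < c -> c <= n -> n <= m -> s + r = n -> 0 < s -> c + r <= m + s ->
  r <= degree (@tight_graph m n c s) v.
Proof.
move=> rc sc cn nm srn s0 crm; rewrite /degree card_sum_set; case: v => [i|j].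
  apply: leq_trans (leq_addl _ _).
  have adjE (j : 'I_n) :
      inr j \in [set z | tight_graph c s (inl i : 'I_m + 'I_n) z] = tight_adj c s i j.
    by rewrite inE.
  have [i0|i0] := eqVneq (i : nat) 0.
    apply: (@card_ord_intervals n r 0 c c c); try lia.
    by move=> j jP; rewrite inE adjE /tight_adj; lia.
  have [ic|ic] := ltnP i c.
    apply: (@card_ord_intervals n r s n n n); try lia.
    by move=> j jP; rewrite inE adjE /tight_adj; lia.
  apply: (@card_ord_intervals n r 0 s s.+1 n); try lia.
  by move=> j jP; rewrite inE adjE /tight_adj; lia.
apply: leq_trans (leq_addr _ _).
have adjE (i : 'I_m) :
    inl i \in [set z | tight_graph c s (inr j : 'I_m + 'I_n) z] = tight_adj c s i j.
  by rewrite inE.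
have [js|js] := ltnP j s.
  apply: (@card_ord_intervals m r 0 s c m); try lia.
  by move=> i iP; rewrite inE adjE /tight_adj; lia.
have [jc|jc] := ltnP j c.
  apply: (@card_ord_intervals m r 0 c c c); try lia.
  by move=> i iP; rewrite inE adjE /tight_adj; lia.
apply: (@card_ord_intervals m r 1 m m m); try lia.
by move=> i iP; rewrite inE adjE /tight_adj; lia.
Qed.

(* The nonedges between the two colour classes form three vertex-disjoint
   complete bipartite graphs. A vertex of one class on one side of the cut and
   one of the other class on the other side lie in the same one of these, which
   leaves four combinations up to symmetry. *)
Lemma tight_graph_connectivity_ge (m n r c s : nat) :
  r <= c -> s < c -> c <= n -> n <= m -> s + r = n -> 0 < s -> c + r <= m + s ->
  r <= connectivity (@tight_graph m n c s).
Proof.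
move=> rc sc cn nm srn s0 crm; set e := @tight_graph m n c s.
have es : symmetric e := (@tight_graph_simple m n c s).1.
have cT : #|{: 'I_m + 'I_n}| = m + n by rewrite card_sum !card_ord.
rewrite /connectivity; case: ifP => _; first by rewrite cT; lia.
apply: leq_bigminn; first by rewrite cT; lia.
move=> D /exists_inP[u0 u0D /exists_inP[v0 v0D nc]].
rewrite !inE in u0D v0D.
pose P := [set z in ~: D | connect (del_vertices e D) u0 z].
pose Q := [set z in ~: D | ~~ connect (del_vertices e D) u0 z].
have PQ u v : u \in P -> v \in Q -> ~~ e u v.
  rewrite !inE => /andP[uD uP] /andP[vD]; apply: contra => uv.
  by apply: connect_trans uP (connect1 _); apply/and3P; split.
have DPQ z : z \notin P -> z \notin Q -> z \in D.
  by rewrite !inE; case: (z \in D) => //=; case: connect.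
have u0P : u0 \in P by rewrite !inE u0D connect0.
have v0Q : v0 \in Q by rewrite !inE v0D.
have QP u v : u \in Q -> v \in P -> ~~ e u v by move=> uQ vP; rewrite es PQ.
apply: contraT; rewrite -ltnNge => Dr.
(* A vertex without neighbours on its own side would have all of them in [D], which is smaller than
   any degree. *)
have nbr (P1 Q1 : {set 'I_m + 'I_n}) u :
    (forall u v, u \in P1 -> v \in Q1 -> ~~ e u v) ->
    (forall z, z \notin P1 -> z \notin Q1 -> z \in D) ->
    u \in P1 -> exists2 v, v \in P1 & e u v.
  move=> PQ1 DPQ1 uP; suff /exists_inP[v] : [exists v in P1, e u v] by exists v.
  apply: contraTT Dr => /exists_inPn nP; rewrite -leqNgt.
  apply: leq_trans (@tight_graph_degree_ge m n r c s u rc sc cn nm srn s0 crm) _.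
  apply: subset_leq_card; apply/subsetP => z; rewrite inE => uz.
  by apply: DPQ1; apply: contraL uz; [apply: nP | apply: PQ1].
(* Hence each side contains an edge and meets both colour classes. *)
have both (P1 Q1 : {set 'I_m + 'I_n}) u :
    (forall u v, u \in P1 -> v \in Q1 -> ~~ e u v) ->
    (forall z, z \notin P1 -> z \notin Q1 -> z \in D) ->
    u \in P1 -> exists i j, inl i \in P1 /\ inr j \in P1.
  move=> PQ1 DPQ1 uP; have [v vP uv] := nbr P1 Q1 u PQ1 DPQ1 uP.
  by case: u v uP vP uv => [i|j] [i'|j'] // *; [exists i, j' | exists i', j].
have [xp [yp [xpP ypP]]] := both P Q u0 PQ DPQ u0P.
have [xq [yq [xqQ yqQ]]] : exists i j, inl i \in Q /\ inr j \in Q.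
  by apply: (both Q P v0 QP) => // z zQ zP; apply: DPQ.
have n1 : ~~ tight_adj c s xp yq := PQ _ _ xpP yqQ.
have n2 : ~~ tight_adj c s xq yp := QP _ _ xqQ ypP.
(* A vertex with neighbours on both sides must be deleted, so [D] contains the common neighbours of
   [yp] and [yq], and likewise those of [xp] and [xq]. *)
have DX (i : 'I_m) : tight_adj c s i yp -> tight_adj c s i yq -> i \in [set a | inl a \in D].
  move=> ip iq; rewrite inE; apply: DPQ.
    by apply: contraL iq => iP; apply: PQ iP yqQ.
  by apply: contraL ip => iQ; apply: QP iQ ypP.
have DY (j : 'I_n) : tight_adj c s xp j -> tight_adj c s xq j -> j \in [set b | inr b \in D].
  move=> jp jq; rewrite inE; apply: DPQ.
    by apply: contraL jq => jP; apply: QP xqQ jP.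
  by apply: contraL jp => jQ; apply: PQ xpP jQ.
suff: r <= #|D| by rewrite leqNgt Dr.
rewrite card_sum_set.
have xpq : (xp : nat) != xq.
  by apply: contraTneq xqQ => /val_inj<-; move: xpP; rewrite !inE => /andP[_ ->]; rewrite andbF.
have ypq : (yp : nat) != yq.
  by apply: contraTneq yqQ => /val_inj<-; move: ypP; rewrite !inE => /andP[_ ->]; rewrite andbF.
have lowX a b a' b' : a <= b -> b <= a' -> a' <= b' -> b' <= m ->
    (forall i : nat, i < m -> a <= i < b \/ a' <= i < b' ->
       tight_adj c s i yp && tight_adj c s i yq) ->
    b - a + (b' - a') <= #|[set a | inl a \in D]|.
  move=> ? ? ? ? h; apply: (@card_ord_intervals m _ a b a' b') => // i /(h i (ltn_ord i)).
  by case/andP; apply: DX.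
have lowY a b a' b' : a <= b -> b <= a' -> a' <= b' -> b' <= n ->
    (forall j : nat, j < n -> a <= j < b \/ a' <= j < b' ->
       tight_adj c s xp j && tight_adj c s xq j) ->
    b - a + (b' - a') <= #|[set b | inr b \in D]|.
  move=> ? ? ? ? h; apply: (@card_ord_intervals n _ a b a' b') => // i /(h i (ltn_ord i)).
  by case/andP; apply: DY.
rewrite /tight_adj in n1 n2 lowX lowY.
have ltx := ltn_ord xp; have ltx' := ltn_ord xq.
have lty := ltn_ord yp; have lty' := ltn_ord yq.
clear - n1 n2 lowX lowY ltx ltx' lty lty' xpq ypq rc sc cn nm srn s0 crm.
move: lowX lowY; set NX := #|_|; set NY := #|_| => lowX lowY.
(* Using the first block twice forces [xp = xq], the second twice [yp = yq]. Otherwise the lower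
   bounds on [#|D|] are [2c - 2] (first and second block), [m - 1] (first and third), [s + r - 1]
   (second and third) and [r] (third twice). *)
move/negPn: n1 => /or3P[]/andP[a1 a2]; move/negPn: n2 => /or3P[]/andP[b1 b2]; try lia.
- have := lowX 1 c c c ltac:(lia) ltac:(lia) ltac:(lia) ltac:(lia) ltac:(lia).
  have := lowY 0 s s.+1 c ltac:(lia) ltac:(lia) ltac:(lia) ltac:(lia) ltac:(lia).
  lia.
- have := lowX 1 s c m ltac:(lia) ltac:(lia) ltac:(lia) ltac:(lia) ltac:(lia).
  have := lowY s c c c ltac:(lia) ltac:(lia) ltac:(lia) ltac:(lia) ltac:(lia).
  lia.
- have := lowX 1 c c c ltac:(lia) ltac:(lia) ltac:(lia) ltac:(lia) ltac:(lia).
  have := lowY 0 s s.+1 c ltac:(lia) ltac:(lia) ltac:(lia) ltac:(lia) ltac:(lia).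
  lia.
- have := lowX 0 s s s ltac:(lia) ltac:(lia) ltac:(lia) ltac:(lia) ltac:(lia).
  have := lowY s.+1 n n n ltac:(lia) ltac:(lia) ltac:(lia) ltac:(lia) ltac:(lia).
  lia.
- have := lowX 1 s c m ltac:(lia) ltac:(lia) ltac:(lia) ltac:(lia) ltac:(lia).
  have := lowY s c c c ltac:(lia) ltac:(lia) ltac:(lia) ltac:(lia) ltac:(lia).
  lia.
- have := lowX 0 s s s ltac:(lia) ltac:(lia) ltac:(lia) ltac:(lia) ltac:(lia).
  have := lowY s.+1 n n n ltac:(lia) ltac:(lia) ltac:(lia) ltac:(lia) ltac:(lia).
  lia.
- have := lowY s n n n ltac:(lia) ltac:(lia) ltac:(lia) ltac:(lia) ltac:(lia).
  lia.
Qed.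

Lemma card_ord_lt (m k : nat) : k <= m -> #|[set i : 'I_m | i < k]| = k.
Proof.
move=> km; apply/eqP; rewrite eqn_leq; apply/andP; split.
  have := cardsC [set i : 'I_m | i < k]; rewrite card_ord.
  have : m - k <= #|~: [set i : 'I_m | i < k]|; last by lia.
  by apply: (@card_ord_intervals m _ k m m m); try lia; move=> i; rewrite !inE; lia.
by apply: (@card_ord_intervals m _ 0 k k k); try lia; move=> i; rewrite !inE; lia.
Qed.

(** This row meets the third zero block, so only the columns from [s] on remain; it caps both
    connectivities of the extremal graph at [r]. *)
Lemma tight_graph_degree_left (m n r c s : nat) (lt_sm : s < m) :
  s < c -> s + r = n -> 0 < s -> degree (@tight_graph m n c s) (inl (Ordinal lt_sm)) = r.
Proof.
move=> sc srn s0; rewrite /degree card_sum_set.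
pose v : 'I_m + 'I_n := inl (Ordinal lt_sm).
have -> : [set i : 'I_m | inl i \in [set z | tight_graph c s v z]] = set0.
  by apply/setP => i; rewrite !inE.
have -> : [set j : 'I_n | inr j \in [set z | tight_graph c s v z]] = ~: [set j : 'I_n | j < s].
  by apply/setP => j; rewrite !inE /= /tight_adj /=; lia.
rewrite cards0; have := cardsC [set j : 'I_n | j < s].
by rewrite card_ord_lt ?card_ord; lia.
Qed.

(** * Expansion from the neighbours of x to those of y *)

(* The left-hand side of the strict inequality counts the copies of [S], and
   the right-hand side those of its neighbours in [N(y)], when the vertices of
   [N(x)] and [N(y)] are multiplied so as to give both measures equal weights. *)
Definition local_expansion (T : finType) (e : rel T) (x y : T) : Prop :=
  forall S : {set T}, S \subset [set u | e x u] -> y \notin S -> S != set0 ->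
    degree e y * #|S| < degree e x * #|[set v | e y v & [exists u in S, e u v]]|.

(** The neighbours of [S] cover all of [N(y)], while [S] omits the neighbour [y] of [x]. *)
Lemma complete_local_expansion (T : finType) (e : rel T) (x y : T) :
  symmetric e -> e x y -> (forall u v, e x u -> e y v -> e u v) ->
  local_expansion e x y.
Proof.
move=> es exy cxy S Sx yS /set0Pn[u uS].
have -> : [set v | e y v & [exists u in S, e u v]] = [set v | e y v].
  apply/setP => v; rewrite !inE; case yv: (e y v) => //=; apply/exists_inP.
  by exists u => //; apply: cxy yv; have := subsetP Sx u uS; rewrite inE.
rewrite -/(degree e y) [ltnRHS]mulnC ltn_pmul2l; last first.
  by apply/card_gt0P; exists x; rewrite inE es.
apply: proper_card; apply/properP; split=> //; exists y => //; by rewrite inE.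
Qed.

(** A violating [S] yields two degree inequalities: [hu] for a vertex [u] of [S], whose neighbours
    in [N(y)] lie in [W], and [hv] for a vertex [v] of [N(y)] without neighbours in [S]. *)
Lemma min_degree_local_expansion (T : finType) (e : rel T) (X Y : {set T}) (x y : T) :
  symmetric e -> bipartition e X Y -> (forall v, #|T| < 3 * degree e v) -> e x y ->
  local_expansion e x y.
Proof.
move=> es bip dT exy.
wlog xX : X Y bip / x \in X.
  move=> H; have [XY XYT eXY] := bip.
  have [xX|xX] := boolP (x \in X); first exact: (H X Y).
  apply: (H Y X); last by have := in_setT x; rewrite -XYT inE (negPf xX).
  by split; [rewrite disjoint_sym | rewrite setUC | move=> a b /eXY; rewrite orbC].
have [XY XYT eXY] := bip.
have notboth z : z \in X -> z \in Y -> False.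
  by move=> zX zY; have /pred0P/(_ z) := XY; rewrite /= zX zY.
have eX a b : a \in X -> e a b -> b \in Y.
  by move=> aX /eXY/orP[/andP[]//|/andP[aY]]; case: (notboth a).
have eY a b : a \in Y -> e a b -> b \in X.
  by move=> aY /eXY/orP[/andP[aX]|/andP[]//]; case: (notboth a).
have yY : y \in Y := eX _ _ xX exy.
have cT : #|X| + #|Y| = #|T|.
  by have := cardsT T; rewrite -XYT => <-; apply/esym/eqP; rewrite (leq_card_setU X Y).
move=> S Sx yS /set0Pn[u uS]; set W := [set v | _ & _]; rewrite ltnNge; apply/negP => h.
have xu : e x u by have := subsetP Sx u uS; rewrite inE.
have SY : S \subset Y by apply/subsetP => z /(subsetP Sx); rewrite inE; apply: eX.
have Ns : degree e y <= #|X|.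
  by apply: subset_leq_card; apply/subsetP => z; rewrite inE; apply: eY.
have sa : #|S| < degree e x.
  by apply: proper_card; apply/properP; split=> //; exists y; rewrite ?inE.
have hu : degree e u + degree e y <= #|W| + #|X|.
  have -> : #|X| = degree e y + #|X :\: [set v | e y v]|.
    rewrite cardsD (setIidPr _); first by rewrite subnKC.
    by apply/subsetP => z; rewrite inE; apply: eY.
  rewrite addnCA addnC leq_add2l; apply: leq_trans _ (leq_card_setU _ _).1.
  apply: subset_leq_card; apply/subsetP => z; rewrite !inE => uz.
  have -> : z \in X by apply: eY uz; apply: (subsetP SY).
  by case yz: (e y z) => //=; rewrite orbF; apply/exists_inP; exists u.
(* If [W] were all of [N(y)], the violation would give [degree e x <= #|S|]. *)
have [v yv vW] : exists2 v, e y v & v \notin W.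
  apply/exists_inP; apply: contraT => /exists_inPn yW.
  have : degree e y <= #|W|.
    apply: subset_leq_card; apply/subsetP => z; rewrite [z \in finset _]inE => yz.
    by have := yW z yz; rewrite negbK.
  have : 0 < degree e y by have := dT y; clear; lia.
  by clear - h sa; nia.
have hv : degree e v + #|S| <= #|Y|.
  have vX : v \in X by apply: eY yv.
  rewrite addnC -leq_subRL; last exact: subset_leq_card.
  rewrite -[in leqRHS](setIidPr SY) -cardsD; apply: subset_leq_card.
  apply/subsetP => z; rewrite !inE => vz; rewrite (eX _ _ vX vz) andbT.
  by apply: contra vW => zS; rewrite inE yv; apply/exists_inP; exists z => //; rewrite es.
have := dT x; have := dT y; have := dT u; have := dT v.
move: (degree e x) (degree e y) (degree e u) (degree e v) #|S| #|W| h Ns sa hu hv.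
rewrite -cT => a b du dv s w h Ns sa hu hv hdv hdu hb ha.
(* [d] is the lower bound on degrees. With [b = d + t], adding [hu] and [hv] gives [w >= s + t + 1],
   so the violation becomes [a * (t + s + 1) <= (d + t) * s]. This contradicts [s <= a] and
   [d <= a]. *)
pose d := ((#|X| + #|Y|) %/ 3).+1.
have d_lo : #|X| + #|Y| < 3 * d by clear; rewrite /d; lia.
have d_hi : 3 * d <= #|X| + #|Y| + 3 by clear; rewrite /d; lia.
clearbody d; have [t bE] : exists t, b = d + t by exists (b - d); clear - hb d_hi; lia.
have da : d <= a by clear - ha d_hi; lia.
have {}h : a * (t + s + 1) <= (d + t) * s.
  rewrite -bE; apply: leq_trans h; rewrite leq_mul2l; apply/orP; right.
  by clear - hu hv hdu hdv d_lo d_hi bE; lia.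
have := leq_mul (ltnW sa) (leqnn t); have := leq_mul da (leqnn s.+1).
by clear - h d_lo; lia.
Qed.

(** Copying each vertex of [N(x)] [degree e y] times and each vertex of [N(y)] [degree e x] times
    makes both sides equally large. One copy of [y] and one of [x] are set aside; strictness in
    [local_expansion] leaves Hall's condition intact for the rest. *)
Lemma blowup_matching (T : finType) (e : rel T) (x y : T)
    (i0 : 'I_(degree e x)) (j0 : 'I_(degree e y)) :
  symmetric e -> e x y -> local_expansion e x y ->
  let D := [set w : T * 'I_(degree e y) | e x w.1 & w != (y, j0)] in
  exists f : T * 'I_(degree e y) -> T * 'I_(degree e x),
    {in D &, injective f} /\
    {in D, forall w, [&& e w.1 (f w).1, e y (f w).1 & f w != (x, i0)]}.
Proof.
move=> es exy hexp D.
apply: (hall_marriage (x, i0)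
  (r := fun w w' => [&& e w.1 w'.1, e y w'.1 & w' != (x, i0)])) => S SD.
set N := finset _.
pose S1 := [set w.1 | w in S].
have S1x : S1 \subset [set u | e x u].
  by apply/subsetP => _ /imsetP[w wS ->]; have := subsetP SD w wS; rewrite !inE => /andP[].
pose W := [set v | e y v & [exists u in S1, e u v]].
(* The successor accounts for the copy [(x, i0)] that is set aside. *)
have cN : #|W| * degree e x <= #|N|.+1.
  have : setX W [set: 'I_(degree e x)] \subset (x, i0) |: N.
    apply/subsetP => -[v i]; rewrite !inE andbT => /andP[yv /exists_inP[_ /imsetP[w wS ->] uv]].
    have [//|ne] := boolP ((v, i) == (x, i0)).
    by apply/exists_inP; exists w => //; apply/and3P; split.
  move/subset_leq_card; rewrite cardsX cardsT card_ord => /leq_trans; apply.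
  by rewrite cardsU1 -add1n leq_add2r leq_b1.
have [->|Sn0] := eqVneq S set0; first by rewrite cards0.
(* If [S] contains a copy of [y], then [W] is all of [N(y)], and the absence of [(y, j0)] from [D]
   compensates for that of [(x, i0)]. *)
have [yS|yS] := boolP (y \in S1).
  have WE : #|W| = degree e y.
    apply: eq_card => v; rewrite !inE; case yv: (e y v) => //=.
    by apply/exists_inP; exists y.
  have cS : #|S| < degree e x * degree e y.
    have := subset_leq_card SD; suff : #|D| < degree e x * degree e y by lia.
    rewrite -[in X in _ * X](card_ord (degree e y)) -cardsT -cardsX.
    apply: proper_card; apply/properP; split.
      by apply/subsetP => -[u j]; rewrite !inE andbT => /andP[].
    by exists (y, j0); rewrite !inE ?exy // eqxx andbF.
  by rewrite WE in cN; rewrite mulnC in cS; lia.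
have S1n0 : S1 != set0.
  by case/set0Pn: Sn0 => w wS; apply/set0Pn; exists w.1; apply: imset_f.
have := hexp S1 S1x yS S1n0; rewrite -/W => h.
have cS : #|S| <= #|S1| * degree e y.
  rewrite -[in X in _ * X](card_ord (degree e y)) -cardsT -cardsX.
  apply: subset_leq_card; apply/subsetP => -[u j] wS; rewrite !inE andbT.
  by apply/imsetP; exists (u, j).
lia.
Qed.

(** If the minimum is [n], every vertex of [X] is joined to all of [Y]; otherwise all degrees exceed
    a third of the number of vertices. *)
Lemma Rthreshold_local_expansion (m n : nat) (T : finType) (e : rel T)
    (X Y : {set T}) (x y : T) :
  symmetric e -> bipartition e X Y -> #|X| = m -> #|Y| = n ->
  (forall v, Rthreshold m n <= degree e v) -> e x y -> local_expansion e x y.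
Proof.
move=> es bip cX cY dR exy; have [XY XYT eXY] := bip.
have cT : m + n = #|T|.
  by have := cardsT T; rewrite -XYT -cX -cY => <-; apply/esym/eqP; rewrite (leq_card_setU X Y).
have [small|large] := leqP n ((m + n) %/ 3).+1; last first.
  apply: (min_degree_local_expansion es bip) => // v.
  by have := dR v; rewrite /Rthreshold -cT; clear - large; lia.
apply: complete_local_expansion => // u v xu yv.
have notboth z : z \in X -> z \in Y -> False.
  by move=> zX zY; have /pred0P/(_ z) := XY; rewrite /= zX zY.
have full w z : w \in X -> z \in Y -> e w z.
  move=> wX; have NY : [set z | e w z] \subset Y.
    apply/subsetP => t; rewrite inE => /eXY/orP[/andP[]//|/andP[wY]].
    by case: (notboth w).
  have /eqP NE : [set z | e w z] == Y.
    by rewrite eqEcard NY cY; have := dR w; rewrite /Rthreshold (minn_idPl small).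
  by rewrite -NE inE.
have side z t : e z t -> (z \in X) = (t \in Y).
  move=> /eXY/orP[/andP[-> ->]//|/andP[zY tX]].
  by apply/idP/idP => [zX|tY]; [case: (notboth z) | case: (notboth t)].
have mem z : (z \in X) || (z \in Y) by have := in_setT z; rewrite -XYT inE.
have [vX|vY] := orP (mem v).
  by rewrite es full // -(side x) // (side x y) // -(side v) // es.
rewrite full //; have [//|uY] := orP (mem u).
have xX : x \in X by rewrite (side x u).
have vX : v \in X by rewrite (side v y (etrans (es v y) yv)) -(side x y exy).
by case: (notboth v).
Qed.

(** * Wasserstein distance and curvature *)

Lemma dist_refl (T : finType) (e : rel T) (x : T) : dist e x x = 0.
Proof.
have T0 : 0 < #|T| by apply/card_gt0P; exists x.
apply/eqP; rewrite -leqn0; apply: (bigminn_le _ _ (j := Ordinal T0)) => /=.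
by apply/existsP; exists [tuple]; rewrite /= eqxx.
Qed.

Lemma dist_adj_le1 (T : finType) (e : rel T) (x y : T) :
  irreflexive e -> e x y -> dist e x y <= 1.
Proof.
move=> ei exy; have T1 : 1 < #|T|.
  by apply/card_gt1P; exists x, y; split=> //; apply: contraTneq exy => ->; rewrite ei.
apply: (bigminn_le _ _ (j := Ordinal T1)) => /=.
by apply/existsP; exists [tuple y]; rewrite /= exy eqxx.
Qed.

From mathcomp Require Import all_order all_algebra.
From mathcomp Require Import all_classical all_reals all_analysis.
From mathcomp Require Import ring lra.

Import Order.TTheory GRing.Theory Num.Theory.
Import numFieldNormedType.Exports.
Local Open Scope ring_scope.

(** Telescoping along a walk; the second hypothesis covers the default value [#|T|] of [dist]. *)
Lemma lipschitz_le_dist (R : realType) (T : finType) (e : rel T) (f : T -> R) (u v : T) :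
  (forall u v, e u v -> f u - f v <= 1) -> (forall u v, f u - f v <= #|T|%:R) ->
  f u - f v <= (dist e u v)%:R.
Proof.
move=> f1 fT; rewrite /dist; elim/big_ind: _ => //.
  by move=> a b fa fb; rewrite /minn; case: ifP.
move=> k /existsP[p /andP[+ /eqP<-]]; rewrite -[X in X%:R](size_tuple p).
elim: (val p) u => [u _|w q IH u /= /andP[uw /IH]]; first by rewrite subrr.
by have := f1 _ _ uw; rewrite -[(size q).+1]addn1 natrD; lra.
Qed.

Lemma sum_lazy_measure (R : realType) (T : finType) (e : rel T) (alpha : R) (x : T) (f : T -> R) :
  irreflexive e ->
  \sum_z f z * lazy_measure e alpha x z =
  alpha * f x + (1 - alpha) / (degree e x)%:R * \sum_(z | e x z) f z.
Proof.
move=> ei; rewrite (bigD1 x) //= {1}/lazy_measure eqxx mulrC; congr (_ + _).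
rewrite mulr_sumr [in RHS]big_mkcond [in LHS]big_mkcond; apply: eq_bigr => z _.
rewrite /lazy_measure; have [->|zx] := eqVneq z x; first by rewrite ei.
by case: ifP => _; rewrite ?mulr0 // mulrC.
Qed.

Lemma sum_lazy_measure1 (R : realType) (T : finType) (e : rel T) (alpha : R) (x : T) :
  irreflexive e -> (0 < degree e x)%N -> \sum_z lazy_measure e alpha x z = 1.
Proof.
move=> ei d0; have := sum_lazy_measure alpha x (fun=> 1) ei.
under eq_bigr do rewrite mul1r; move=> ->.
have -> : \sum_(z | e x z) 1 = (degree e x)%:R :> R.
  by rewrite /degree -sum1_card natr_sum; apply: eq_bigl => z; rewrite inE.
by rewrite mulr1 divfK ?pnatr_eq0 -?lt0n //; lra.
Qed.

Lemma lazy_measure_ge0 (R : realType) (T : finType) (e : rel T) (alpha : R) (x z : T) :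
  0 <= alpha <= 1 -> 0 <= lazy_measure e alpha x z.
Proof.
move=> /andP[a0 a1]; rewrite /lazy_measure; case: ifP => // _; case: ifP => // _.
by rewrite divr_ge0 ?ler0n ?subr_ge0.
Qed.

Lemma le_sum_term (R : realType) (T : finType) (f : T -> R) (u : T) :
  (forall v, 0 <= f v) -> f u <= \sum_v f v.
Proof. by move=> f0; rewrite (bigD1 u) //= lerDl sumr_ge0. Qed.

Lemma couplingI (R : realType) (T : finType) (mu1 mu2 : T -> R) (p : T -> T -> R) :
  (forall u v, 0 <= p u v) -> \sum_u mu1 u <= 1 ->
  (forall u, \sum_v p u v = mu1 u) -> (forall v, \sum_u p u v = mu2 v) ->
  coupling mu1 mu2 p.
Proof.
move=> p0 mu1_le1 pr pc; split=> // u v; rewrite p0 /=.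
apply: le_trans mu1_le1; apply: le_trans (le_sum_term u _); last first.
  by move=> w; rewrite -pr sumr_ge0.
by rewrite -pr; apply: le_sum_term.
Qed.

(** The product coupling makes the set of costs nonempty, so that lower bounds pass to its
    infimum. *)
Lemma coupling_prod (R : realType) (T : finType) (mu1 mu2 : T -> R) :
  (forall u, 0 <= mu1 u) -> (forall u, 0 <= mu2 u) ->
  \sum_u mu1 u = 1 -> \sum_u mu2 u = 1 -> coupling mu1 mu2 (fun u v => mu1 u * mu2 v).
Proof.
move=> m1 m2 s1 s2; apply: couplingI.
- by move=> u v; rewrite mulr_ge0.
- by rewrite s1.
- by move=> u; rewrite -mulr_sumr s2 mulr1.
- by move=> v; rewrite -mulr_suml s1 mul1r.
Qed.

Lemma transport_cost_ge0 (R : realType) (T : finType) (e : rel T)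
    (mu1 mu2 : T -> R) (p : T -> T -> R) :
  coupling mu1 mu2 p -> 0 <= transport_cost e p.
Proof.
case=> p01 _ _; apply: sumr_ge0 => u _; apply: sumr_ge0 => v _.
by have /andP[p0 _] := p01 u v; rewrite mulr_ge0 ?ler0n.
Qed.

Lemma wasserstein_le (R : realType) (T : finType) (e : rel T)
    (mu1 mu2 : T -> R) (p : T -> T -> R) :
  coupling mu1 mu2 p -> wasserstein e mu1 mu2 <= transport_cost e p.
Proof.
move=> pC; apply: ge_inf; last by exists p.
by exists 0 => _ [q qC <-]; apply: transport_cost_ge0 qC.
Qed.

Lemma wasserstein_ge (R : realType) (T : finType) (e : rel T) (mu1 mu2 : T -> R) (k : R) :
  (forall u, 0 <= mu1 u) -> (forall u, 0 <= mu2 u) ->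
  \sum_u mu1 u = 1 -> \sum_u mu2 u = 1 ->
  (forall p, coupling mu1 mu2 p -> k <= transport_cost e p) ->
  k <= wasserstein e mu1 mu2.
Proof.
move=> m1 m2 s1 s2 kp; apply: lb_le_inf; last by move=> _ [q qC <-]; apply: kp.
have pC := coupling_prod m1 m2 s1 s2.
by exists (transport_cost e (fun u v => mu1 u * mu2 v)); exists (fun u v => mu1 u * mu2 v).
Qed.

(** The easy half of Kantorovich duality: [f u - f v] is integrated against the coupling. *)
Lemma lipschitz_le_cost (R : realType) (T : finType) (e : rel T)
    (mu1 mu2 : T -> R) (p : T -> T -> R) (f : T -> R) :
  (forall u v, f u - f v <= (dist e u v)%:R) -> coupling mu1 mu2 p ->
  \sum_z f z * mu1 z - \sum_z f z * mu2 z <= transport_cost e p.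
Proof.
move=> fL [p01 pr pc].
have -> : \sum_z f z * mu1 z = \sum_u \sum_v f u * p u v.
  by apply: eq_bigr => u _; rewrite -pr mulr_sumr.
have -> : \sum_z f z * mu2 z = \sum_u \sum_v f v * p u v.
  by rewrite exchange_big; apply: eq_bigr => v _; rewrite -pc mulr_sumr.
rewrite -sumrB; apply: ler_sum => u _; rewrite -sumrB; apply: ler_sum => v _.
by rewrite -mulrBl ler_wpM2r //; case/andP: (p01 u v).
Qed.

(** * Monotonicity in the laziness and existence of the limit *)

(** With [t = (1 - b) / (1 - a)], the measure of laziness [b] is [t] times that of laziness [a] plus
    a point mass [1 - t]. Moving the point mass from [x] to [y] costs at most [1 - t], so [kappa] at
    [b] is at least [t] times [kappa] at [a]. *)
Lemma kappa_div_homo (R : realType) (T : finType) (e : rel T) (x y : T) (a b : R) :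
  simple_graph e -> e x y -> 0 <= a -> a <= b -> b < 1 ->
  kappa e a x y / (1 - a) <= kappa e b x y / (1 - b).
Proof.
move=> [es ei] exy a0 ab b1.
have dx : (0 < degree e x)%N by apply/card_gt0P; exists y; rewrite inE.
have dy : (0 < degree e y)%N by apply/card_gt0P; exists x; rewrite inE es.
have a1 : a < 1 by lra.
set t := (1 - b) / (1 - a).
have t0 : 0 < t by rewrite divr_gt0 ?subr_gt0.
have t1 : t <= 1 by rewrite ler_pdivrMr ?subr_gt0 // mul1r; lra.
have tE : t * (1 - a) = 1 - b by rewrite /t divfK //; lra.
have lazyE z w : lazy_measure e b z w = t * lazy_measure e a z w + (1 - t) * (w == z)%:R.
  rewrite /lazy_measure; case: eqP => _; first by rewrite mulr1; lra.
  by case: ifP => _; rewrite ?mulr0 ?addr0 // -tE mulrA.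
suff key : wasserstein e (lazy_measure e b x) (lazy_measure e b y)
    <= t * wasserstein e (lazy_measure e a x) (lazy_measure e a y) + (1 - t).
  rewrite -tE invfM mulrA ler_pM2r ?invr_gt0 ?subr_gt0 // ler_pdivlMr // /kappa; lra.
have lin p : coupling (lazy_measure e a x) (lazy_measure e a y) p ->
    wasserstein e (lazy_measure e b x) (lazy_measure e b y) <= t * transport_cost e p + (1 - t).
  move=> pC; have [p01 pr pc] := pC.
  pose q u v := t * p u v + (1 - t) * ((u == x) && (v == y))%:R.
  have delta_row u : \sum_v ((u == x) && (v == y))%:R = (u == x)%:R :> R.
    rewrite (bigD1 y) //= eqxx andbT big1 ?addr0 // => v /negPf->.
    by rewrite andbF.
  have delta_col v : \sum_u ((u == x) && (v == y))%:R = (v == y)%:R :> R.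
    by rewrite (bigD1 x) //= eqxx big1 ?addr0 // => u /negPf->.
  have qC : coupling (lazy_measure e b x) (lazy_measure e b y) q.
    apply: couplingI.
    - move=> u v; have /andP[p0 _] := p01 u v.
      by rewrite addr_ge0 // mulr_ge0 ?ler0n ?subr_ge0 // ltW.
    - by rewrite sum_lazy_measure1.
    - by move=> u; rewrite big_split /= -!mulr_sumr pr delta_row lazyE.
    - by move=> v; rewrite big_split /= -!mulr_sumr pc delta_col lazyE.
  apply: le_trans (wasserstein_le e qC) _.
  have -> : transport_cost e q = t * transport_cost e p + (1 - t) * (dist e x y)%:R.
    rewrite /transport_cost mulr_sumr.
    have -> : (1 - t) * (dist e x y)%:R =
        \sum_u \sum_v (1 - t) * ((dist e u v)%:R * ((u == x) && (v == y))%:R).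
      rewrite (bigD1 x) //= (bigD1 y) //= !eqxx mulr1 big1 ?addr0; last first.
        by move=> v /negPf->; rewrite !mulr0.
      rewrite big1 ?addr0 // => u /negPf->; apply: big1 => v _.
      by rewrite !mulr0.
    rewrite -big_split /=; apply: eq_bigr => u _.
    rewrite mulr_sumr -big_split /=; apply: eq_bigr => v _; rewrite /q; ring.
  rewrite lerD2l ler_piMr ?subr_ge0 //.
  by rewrite lern1 dist_adj_le1.
rewrite -lerBlDr -ler_pdivrMl //; apply: wasserstein_ge.
- by move=> u; apply: lazy_measure_ge0; rewrite a0 ltW.
- by move=> u; apply: lazy_measure_ge0; rewrite a0 ltW.
- by rewrite sum_lazy_measure1.
- by rewrite sum_lazy_measure1.
by move=> p /lin; rewrite ler_pdivrMl // lerBlDr.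
Qed.

(** Testing with the indicator of [x] bounds the Wasserstein distance below by
    [a - (1 - a) / degree e y], hence by [2 * a - 1]. *)
Lemma kappa_div_le2 (R : realType) (T : finType) (e : rel T) (x y : T) (a : R) :
  simple_graph e -> e x y -> 0 <= a -> a < 1 -> kappa e a x y / (1 - a) <= 2.
Proof.
move=> [es ei] exy a0 a1.
have dx : (0 < degree e x)%N by apply/card_gt0P; exists y; rewrite inE.
have dy : (0 < degree e y)%N by apply/card_gt0P; exists x; rewrite inE es.
have xy : x != y by apply: contraTneq exy => ->; rewrite ei.
have a01 : 0 <= a <= 1 by rewrite a0 ltW.
rewrite ler_pdivrMr ?subr_gt0 // /kappa.
suff : 2 * a - 1 <= wasserstein e (lazy_measure e a x) (lazy_measure e a y) by lra.
apply: wasserstein_ge; rewrite ?sum_lazy_measure1 //.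
- by move=> u; apply: lazy_measure_ge0.
- by move=> u; apply: lazy_measure_ge0.
move=> p; pose f z : R := (z == x)%:R.
have f1 u v : f u - f v <= 1 by rewrite /f; case: (u == x); case: (v == x) => /=; lra.
have fL u v : f u - f v <= (dist e u v)%:R.
  apply: lipschitz_le_dist => // {}u {}v; apply: le_trans (f1 u v) _.
  by rewrite ler1n; apply/card_gt0P; exists x.
move/(lipschitz_le_cost fL); apply: le_trans.
have fS (mu : T -> R) : \sum_z f z * mu z = mu x.
  rewrite (bigD1 x) //= /f eqxx mul1r big1 ?addr0 // => z /negPf->.
  by rewrite mul0r.
rewrite !fS /lazy_measure eqxx (negPf xy) es exy.
suff : (1 - a) / (degree e y)%:R <= 1 - a by lra.
by rewrite ler_pdivrMr ?ltr0n // ler_peMr ?ler1n // subr_ge0 ltW.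
Qed.

Lemma is_cvg_kappa_LLY (R : realType) (T : finType) (e : rel T) (x y : T) :
  simple_graph e -> e x y -> cvg (kappa e alpha x y / (1 - alpha) @[alpha --> (1 : R)^'-])%classic.
Proof.
move=> se exy; apply: nondecreasing_at_left_is_cvgr.
  near=> z => a b; rewrite !in_itv /= => /andP[za _] /andP[_ b1] ab.
  apply: kappa_div_homo => //; apply: le_trans (ltW za).
  by near: z; apply: nbhs_left_ge; exact: ltr01.
near=> z; exists 2 => _ [a + <-]; rewrite /= in_itv /= => /andP[za a1].
apply: kappa_div_le2 => //; apply: le_trans (ltW za).
by near: z; apply: nbhs_left_ge; exact: ltr01.
Unshelve. all: by end_near. Qed.

(** By monotonicity a single laziness bounds the limit from below, so positivity can be checked at
    laziness one half. *)
Lemma kappa_LLY_ge (R : realType) (T : finType) (e : rel T) (x y : T) (a : R) :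
  simple_graph e -> e x y -> 0 <= a -> a < 1 ->
  kappa e a x y / (1 - a) <= kappa_LLY R e x y.
Proof.
move=> se exy a0 a1; apply: limr_ge; first exact: is_cvg_kappa_LLY.
near=> b; apply: kappa_div_homo => //.
by near: b; apply: nbhs_left_ge.
Unshelve. all: by end_near. Qed.

Lemma kappa_LLY_le0 (R : realType) (T : finType) (e : rel T) (x y : T) :
  simple_graph e -> e x y -> (forall a : R, 0 <= a -> a < 1 -> kappa e a x y <= 0) ->
  kappa_LLY R e x y <= 0.
Proof.
move=> se exy k0; apply: limr_le; first exact: is_cvg_kappa_LLY.
near=> b; have b1 : b < 1 by near: b; apply: nbhs_left_lt.
rewrite ler_pdivrMr ?subr_gt0 // mul0r; apply: k0 => //.
by near: b; apply: nbhs_left_ge; exact: ltr01.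
Unshelve. all: by end_near. Qed.

(** * Positive curvature from local expansion *)

Lemma sum_delta_pair (R : realType) (T : finType) (g : T -> T -> R) (z z' : T) :
  \sum_u \sum_v g u v * ((u == z) && (v == z'))%:R = g z z'.
Proof.
rewrite (bigD1 z) //= (bigD1 z') //= !eqxx mulr1 big1 ?addr0; last first.
  by move=> v /negPf->; rewrite mulr0.
rewrite big1 ?addr0 // => u /negPf->; apply: big1 => v _; exact: mulr0.
Qed.

(** Evaluates the marginals of the transport plan, with the copy set aside put back. *)
Lemma sum_delta_fst (R : realType) (T : finType) (d : nat) (P : pred T) (y u : T) (j0 : 'I_d) :
  P y -> \sum_(w : T * 'I_d | P w.1 && (w != (y, j0))) (u == w.1)%:R + (u == y)%:R
         = d%:R * (P u)%:R :> R.
Proof.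
move=> Py; rewrite addrC -(bigD1 (y, j0) (F := fun w : T * 'I_d => (u == w.1)%:R)) //=.
have -> : \sum_(w : T * 'I_d | P w.1) (u == w.1)%:R
    = \sum_(z | P z) \sum_(j < d) (u == z)%:R :> R.
  by rewrite pair_big_dep; apply: eq_bigl => w; rewrite andbT.
under eq_bigr do rewrite sumr_const card_ord -[_ *+ d]mulr_natl.
rewrite -mulr_sumr; congr (_ * _); case Pu: (P u); last first.
  by apply: big1 => z Pz; case: eqVneq Pz => // <-; rewrite Pu.
by rewrite (bigD1 u) //= eqxx big1 ?addr0 // => z /andP[_ /negPf]; rewrite eq_sym => ->.
Qed.

Lemma card_setX_pred_minus1 (T : finType) (d : nat) (P : pred T) (y : T) (j0 : 'I_d) :
  P y -> #|[set w : T * 'I_d | P w.1 && (w != (y, j0))]%SET|.+1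
         = (#|[set z | P z]%SET| * d)%N.
Proof.
move=> Py; rewrite -[d in RHS]card_ord -cardsT -cardsX [RHS](cardsD1 (y, j0)).
rewrite !inE Py add1n; congr _.+1; apply: eq_card => -[z j].
by rewrite !inE andbT andbC.
Qed.

(* Move a perfect matching of the copies of [N(x)] and [N(y)], all along edges,
   together with the atom at [x], which goes to [y]. This costs exactly 1. The
   matching may be chosen to send a copy of [y] to a copy of [x]; letting these
   two and an equal part of the atom rest saves [2 * c]. *)
Lemma local_expansion_kappa_LLY_gt0 (R : realType) (T : finType) (e : rel T) (x y : T) :
  simple_graph e -> e x y -> local_expansion e x y -> 0 < kappa_LLY R e x y.
Proof.
move=> se exy hexp; have [es ei] := se.
have eyx : e y x by rewrite es.
have dx : (0 < degree e x)%N by apply/card_gt0P; exists y; rewrite inE.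
have dy : (0 < degree e y)%N by apply/card_gt0P; exists x; rewrite inE.
pose i0 := Ordinal dx; pose j0 := Ordinal dy.
have [f [fI fP]] := blowup_matching i0 j0 es exy hexp.
set D := [set w | _]%SET in fI fP.
pose D' := [set w : T * 'I_(degree e x) | e y w.1 && (w != (x, i0))]%SET.
have cD : #|D|.+1 = (degree e x * degree e y)%N by apply: card_setX_pred_minus1.
have cD' : #|D'|.+1 = (degree e y * degree e x)%N by apply: card_setX_pred_minus1.
(* Both sides have [degree e x * degree e y - 1] copies left, so the injection [f] is onto [D']. *)
have fD : [set f w | w in D]%SET = D'.
  apply/eqP; rewrite eqEcard card_in_imset //; apply/andP; split.
    by apply/fintype.subsetP => _ /imsetP[w /fP/and3P[_ yw nw] ->]; rewrite inE yw nw.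
  by rewrite -ltnS cD cD' mulnC.
(* The mass of one copy: at laziness one half, mass one half is spread evenly over all copies. *)
pose c : R := 2^-1 / ((degree e x)%:R * (degree e y)%:R).
have ax : (degree e x)%:R != 0 :> R by rewrite pnatr_eq0 -lt0n.
have ay : (degree e y)%:R != 0 :> R by rewrite pnatr_eq0 -lt0n.
have c0 : 0 < c by rewrite divr_gt0 ?invr_gt0 ?mulr_gt0 ?ltr0n.
have c2 : c <= 2^-1.
  by rewrite ler_pdivrMr ?mulr_gt0 ?ltr0n // ler_peMr ?invr_ge0 // -natrM ler1n muln_gt0 dx.
(* Matched copies move along edges, mass [c] rests at each of [y] and [x], and the remaining
   [2^-1 - c] of the atom goes from [x] to [y]. *)
pose p u v : R := c * (\sum_(w in D) ((u == w.1) && (v == (f w).1))%:R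
    + ((u == y) && (v == y))%:R + ((u == x) && (v == x))%:R)
    + (2^-1 - c) * ((u == x) && (v == y))%:R.
have row (z z' u : T) : \sum_v ((u == z) && (v == z'))%:R = (u == z)%:R :> R.
  by rewrite (bigD1 z') //= eqxx andbT big1 ?addr0 // => v /negPf->; rewrite andbF.
have col (z z' v : T) : \sum_u ((u == z) && (v == z'))%:R = (v == z')%:R :> R.
  by rewrite (bigD1 z) //= eqxx big1 ?addr0 // => u /negPf->.
have half : 0 <= (2^-1 : R) <= 1 by lra.
have pC : coupling (lazy_measure e 2^-1 x) (lazy_measure e 2^-1 y) p.
  apply: couplingI.
  - move=> u v; rewrite addr_ge0 ?mulr_ge0 ?subr_ge0 ?(ltW c0) //.
    by rewrite !addr_ge0 // sumr_ge0.
  - by rewrite sum_lazy_measure1.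
  - move=> u; rewrite big_split -!mulr_sumr !big_split /= exchange_big !row.
    under eq_bigr do rewrite row.
    have -> : \sum_(w in D) (u == w.1)%:R + (u == y)%:R = (degree e y)%:R * (e x u)%:R :> R.
      by rewrite -(sum_delta_fst _ u j0 exy); congr (_ + _); apply: eq_bigl => w; rewrite inE.
    rewrite /lazy_measure; case: eqVneq => [->|_].
      by rewrite ei /=; lra.
    by case: (e x u); rewrite /= ?mulr0 ?addr0 ?mulr0 // !mulr1 /c; field; rewrite ax ay.
  - move=> v; rewrite big_split -!mulr_sumr !big_split /= exchange_big !col.
    under eq_bigr do rewrite col.
    have -> : \sum_(w in D) (v == (f w).1)%:R = \sum_(w in D') (v == w.1)%:R :> R.
      by rewrite -fD big_imset.
    have dE : \sum_(w in D') (v == w.1)%:R + (v == x)%:R = (degree e x)%:R * (e y v)%:R :> R.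
      by rewrite -(sum_delta_fst _ v i0 eyx); congr (_ + _); apply: eq_bigl => w; rewrite inE.
    rewrite addrAC dE /lazy_measure; case: eqVneq => [->|_].
      by rewrite ei /=; lra.
    by case: (e y v); rewrite /= ?mulr0 ?addr0 ?mulr0 // !mulr1 /c; field; rewrite ax ay.
have cost : transport_cost e p <= 1 - 2 * c.
  have -> : transport_cost e p = c * (\sum_(w in D) (dist e w.1 (f w).1)%:R
      + (dist e y y)%:R + (dist e x x)%:R) + (2^-1 - c) * (dist e x y)%:R.
    pose g u v : R := (dist e u v)%:R.
    rewrite -!/(g _ _); under eq_bigr do rewrite -/(g _ _) -(sum_delta_pair g).
    rewrite exchange_big /=.
    rewrite -(sum_delta_pair g x y) -(sum_delta_pair g x x) -(sum_delta_pair g y y).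
    rewrite -!big_split !mulr_sumr -big_split /=; apply: eq_bigr => u _.
    rewrite exchange_big /= -!big_split !mulr_sumr -big_split /=; apply: eq_bigr => v _.
    by rewrite -mulr_sumr /p -/(g u v) /=; ring.
  rewrite !dist_refl !addr0.
  have le1 : \sum_(w in D) (dist e w.1 (f w).1)%:R <= #|D|%:R :> R.
    rewrite -sum1_card natr_sum; apply: ler_sum => w /fP/and3P[ew _ _].
    by rewrite lern1 dist_adj_le1.
  have le2 : (dist e x y)%:R <= 1 :> R by rewrite lern1 dist_adj_le1.
  have cDE : c * #|D|%:R = 2^-1 - c.
    have -> : #|D|%:R = (degree e x)%:R * (degree e y)%:R - 1 :> R.
      by rewrite -natrM -cD -addn1 natrD addrK.
    by rewrite /c; field; rewrite ax ay.
  have := ler_wpM2l (ltW c0) le1; have := ler_wpM2l (_ : 0 <= 2^-1 - c) le2.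
  by rewrite subr_ge0 => /(_ c2); rewrite cDE; lra.
apply: lt_le_trans (kappa_LLY_ge se exy (_ : 0 <= 2^-1) (_ : 2^-1 < 1)); try lra.
apply: divr_gt0; last lra.
by have := wasserstein_le e pC; rewrite /kappa; lra.
Qed.

(** * Nonpositive curvature in the extremal graph *)

(** The integrals of the test function are [a + (1 - a) * 2s / c] and [(1 - a) * (2s - c) / c]. They
    differ by exactly 1, so the distance is at least 1 at every laziness [a]. *)
Lemma tight_graph_kappa_LLY_le0 (R : realType) (m n c s : nat) (m0 : (0 < m)%N) (sn : (s < n)%N) :
  (0 < s)%N -> (s < c)%N -> (c <= n)%N -> (n <= m)%N ->
  kappa_LLY R (@tight_graph m n c s) (inl (Ordinal m0)) (inr (Ordinal sn)) <= 0.
Proof.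
move=> s0 sc cn nm; set e := @tight_graph m n c s; set x := inl _; set y := inr _.
have se : simple_graph e := @tight_graph_simple m n c s; have [es ei] := se.
have exy : e x y by rewrite /e /= /tight_adj /=; lia.
have eyx : e y x by rewrite es.
have dx : (0 < degree e x)%N by apply/card_gt0P; exists y; rewrite inE.
have dy : (0 < degree e y)%N by apply/card_gt0P; exists x; rewrite inE.
apply: kappa_LLY_le0 => // a a0 a1; have a01 : 0 <= a <= 1 by rewrite a0 ltW.
rewrite /kappa subr_le0; apply: wasserstein_ge; rewrite ?sum_lazy_measure1 //.
- by move=> u; apply: lazy_measure_ge0.
- by move=> u; apply: lazy_measure_ge0.
(* The values 2 and -1 occur exactly on the columns and the rows of the third zero block, so [f]
   changes by at most 1 along edges. *)
move=> p; pose f (z : 'I_m + 'I_n) : R := match z with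
  | inl i => if (s <= i < c)%N then -1 else 1
  | inr j => if (j < s)%N then 2 else 0
  end.
have fL u v : f u - f v <= (dist e u v)%:R.
  apply: lipschitz_le_dist => {u v}.
    case=> [i|j] [i'|j'] //=; rewrite /tight_adj; do 2! case: ifP => ? //; try lra; lia.
  move=> u v; have T3 : 3 <= #|{: 'I_m + 'I_n}|%:R :> R.
    by rewrite card_sum !card_ord ler_nat; lia.
  by apply: le_trans T3; case: u v => [i|j] [i'|j'] /=; do 2! case: ifP => _; lra.
move/(lipschitz_le_cost fL); apply: le_trans.
rewrite !sum_lazy_measure //.
have dxE : degree e x = c.
  rewrite /degree card_sum_set -[RHS](card_ord_lt cn) -[RHS]add0n.
  by congr (_ + _)%N; [apply: eq_card0 | apply: eq_card] => z; rewrite !inE //= /tight_adj /=; lia.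
have dyE : degree e y = c.
  rewrite /degree card_sum_set -[RHS](card_ord_lt (leq_trans cn nm)) -[RHS]addn0.
  by congr (_ + _)%N; [apply: eq_card | apply: eq_card0] => z; rewrite !inE //= /tight_adj /=; lia.
have sx : \sum_(z | e x z) f z = 2 * s%:R.
  rewrite big_sumType /= big_pred0 ?add0r; last by [].
  rewrite -big_mkcondr /= sumr_const -[_ *+ _]mulr_natr; congr (_ * _%:R).
  by rewrite -[RHS](card_ord_lt (ltnW sn)); apply: eq_card => j; rewrite !inE /tight_adj /=; lia.
have sy : \sum_(z | e y z) f z = 2 * s%:R - c%:R.
  rewrite big_sumType /= [X in _ + X]big_pred0 ?addr0; last by [].
  rewrite (eq_big (fun i : 'I_m => (i < c)%N) (fun i : 'I_m => 2 * (i < s)%:R - 1)).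
  - rewrite sumrB -mulr_sumr; congr (2 * _ - _).
      transitivity (\sum_(i < m | (i < s)%N) 1 : R).
        rewrite [RHS]big_mkcond [LHS]big_mkcond; apply: eq_bigr => i _.
        by case: ltnP => ic; case: ltnP => // si; exfalso; lia.
      rewrite sumr_const; congr _%:R.
      by rewrite -[RHS](@card_ord_lt m) ?cardsE //; lia.
    rewrite sumr_const; congr _%:R.
    by rewrite -[RHS](@card_ord_lt m) ?cardsE //; lia.
  - by move=> i; rewrite /= /tight_adj /=; lia.
  - move=> i; rewrite /= /tight_adj /= => ic; case: ifP => si.
      have -> : (i < s)%N = false by lia.
      by rewrite mulr0 sub0r.
    have -> : (i < s)%N by lia.
    by rewrite mulr1; lra.
have fx : f x = 1 by rewrite /f /= leqNgt s0.
have fy : f y = 0 by rewrite /f /= ltnn.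
rewrite sx sy dxE dyE fx fy.
have c0 : c%:R != 0 :> R by rewrite pnatr_eq0; lia.
by rewrite le_eqVlt; apply/orP; left; apply/eqP; field.
Qed.

Theorem corollary1p2 (R : realType) :
  (forall (m n : nat) (T : finType) (e : rel T) (X Y : {set T}),
     (n <= m)%N ->
     simple_graph e -> bipartition e X Y -> #|X| = m -> #|Y| = n ->
     (Rthreshold m n <= connectivity e)%N \/
     (Rthreshold m n <= edge_connectivity e)%N ->
     forall x y : T, e x y -> 0 < kappa_LLY R e x y)
  /\
  (forall m n : nat, (2 <= n)%N -> (n <= m)%N ->
     exists (T : finType) (e : rel T) (X Y : {set T}),
       [/\ simple_graph e, bipartition e X Y, #|X| = m & #|Y| = n] /\
       [/\ connectivity e = (Rthreshold m n).-1,
           edge_connectivity e = (Rthreshold m n).-1 &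
           exists x y : T, e x y /\ kappa_LLY R e x y <= 0]).
Proof.
split.
  move=> m n T e X Y _ se bip cX cY hR x y exy; have [es ei] := se.
  apply: local_expansion_kappa_LLY_gt0 => //.
  apply: (Rthreshold_local_expansion es bip cX cY _ exy) => v.
  case: hR => /leq_trans; apply; first exact: connectivity_le_degree.
  exact: edge_connectivity_le_degree.
(* [s] is forced by the row degrees [n - s = r]. The degree [c] of the two ends must be at least
   [r], and larger than [s] for the third zero block to be nonempty. *)
move=> m n n2 nm; pose r := (Rthreshold m n).-1; pose s := (n - r)%N; pose c := maxn r s.+1.
have rE : r = minn n.-1 ((m + n) %/ 3) by rewrite /r /Rthreshold; lia.
have [rn r3] : (r < n)%N /\ (3 * r <= m + n)%N by rewrite rE; split; lia.
have r0 : (0 < r)%N by rewrite rE; lia.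
have srn : (s + r = n)%N by rewrite /s; lia.
have s0 : (0 < s)%N by lia.
have rc : (r <= c)%N := leq_maxl _ _.
have sc : (s < c)%N := leq_maxr _ _.
have cn : (c <= n)%N by rewrite geq_max; lia.
(* For [c = r] this is [3 * r <= m + n]; for [c = s + 1] it is [n + 1 <= m + s]. *)
have crm : (c + r <= m + s)%N by rewrite /c /maxn; case: ifP; lia.
have m0 : (0 < m)%N by lia.
have sn : (s < n)%N by lia.
have sm : (s < m)%N by lia.
have se := @tight_graph_simple m n c s.
have k_ge := tight_graph_connectivity_ge rc sc cn nm srn s0 crm.
have kk' : (connectivity (@tight_graph m n c s) <= edge_connectivity (@tight_graph m n c s))%N.
  by apply: connectivity_le_edge_connectivity => //; rewrite card_sum !card_ord; lia.
have k'_le := edge_connectivity_le_degree (inl (Ordinal sm)) se.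
rewrite (tight_graph_degree_left sm sc srn s0) in k'_le.
exists ('I_m + 'I_n)%type, (@tight_graph m n c s),
  [set inl i | i : 'I_m]%SET, [set inr j | j : 'I_n]%SET; split; split=> //.
- exact: tight_graph_bipartition.
- by rewrite card_imset ?card_ord // => i j [].
- by rewrite card_imset ?card_ord // => i j [].
(* Both equalities come from the chain of bounds [r], connectivity, edge-connectivity, minimum
   degree, [r]. *)
- by apply/eqP; rewrite eqn_leq k_ge (leq_trans kk').
- by apply/eqP; rewrite eqn_leq k'_le (leq_trans k_ge).
exists (inl (Ordinal m0)), (inr (Ordinal sn)); split.
  by rewrite /= /tight_adj /=; lia.
exact: tight_graph_kappa_LLY_le0.
Qed.
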